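(* As formal power series in $q$, \begin{align*} \sum_{n=0}^{\infty} S(4n)q^n & = \frac{f_4^3f_6^7}{f_1f_2^2f_3^5f_{12}^3}, & \sum_{n=0}^{\infty} S(4n+1)q^n & = \frac{f_2f_4f_{6}^4}{f_1^2f_3^4f_{12}}, \\ \sum_{n=0}^{\infty} S(4n+2)q^n & = \frac{f_2^4f_6f_{12}}{f_1^3f_3^3f_4}, & \sum_{n=0}^{\infty} S(4n+3)q^n & = \frac{f_2^7f_{12}^3}{f_1^4f_3^2f_4^3f_6^2}. \end{align*}
   Context: Let $(a;q)_\infty:=\prod_{k\geq 0}(1-aq^k)$ and, for a positive integer $r$, $f_r:=(q^r;q^r)_\infty=\prod_{k\geq1}(1-q^{rk})$. The function $S(n)$ (the number of overpartitions of $n$ of Schur-type, in the sense of Broudy and Lovejoy) is defined by the generating function $$\sum_{n=0}^{\infty} S(n)q^n = \frac{1}{(q;q^6)_\infty(q^5;q^6)_\infty(q^6;q^6)_\infty}.$$ *)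

(* Defs.v *)
From HB Require Import structures.
From mathcomp Require Import all_boot all_order all_algebra.
From mathcomp Require Import boolp.

Set Implicit Arguments.
Unset Strict Implicit.
Unset Printing Implicit Defensive.

Import GRing.Theory.
Local Open Scope ring_scope.

(* Formal power series sum_n a_n q^n, represented by n |-> a_n. The type is a
   record, and not nat -> R, because functions into a ring carry the pointwise
   product. *)
Record fps (R : Type) := FPS { fps_coef :> nat -> R }.

HB.instance Definition _ (R : Type) := gen_eqMixin (fps R).
HB.instance Definition _ (R : Type) := gen_choiceMixin (fps R).

Lemma fpsP (R : Type) (a b : fps R) : a =1 b <-> a = b.
Proof.
by split=> [|-> //]; case: a b => [a] [b] /= ab; congr FPS; apply/funext.
Qed.

Section Zmod.
Variable R : zmodType.
Implicit Types a b c x : fps R.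

Definition fps_zero : fps R := FPS (fun=> 0).
Definition fps_opp a : fps R := FPS (fun n => - a n).
Definition fps_add a b : fps R := FPS (fun n => a n + b n).

Fact fps_addA : associative fps_add.
Proof. by move=> a b c; apply/fpsP => n /=; rewrite addrA. Qed.
Fact fps_addC : commutative fps_add.
Proof. by move=> a b; apply/fpsP => n /=; rewrite addrC. Qed.
Fact fps_add0 : left_id fps_zero fps_add.
Proof. by move=> a; apply/fpsP => n /=; rewrite add0r. Qed.
Fact fps_addN : left_inverse fps_zero fps_opp fps_add.
Proof. by move=> a; apply/fpsP => n /=; rewrite addNr. Qed.

HB.instance Definition _ := GRing.isZmodule.Build (fps R)
  fps_addA fps_addC fps_add0 fps_addN.

Lemma fps_coef0 n : (0 : fps R) n = 0. Proof. by []. Qed.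
Lemma fps_coefD a b n : (a + b) n = a n + b n. Proof. by []. Qed.
Lemma fps_coefN a n : (- a) n = - a n. Proof. by []. Qed.
Lemma fps_coefB a b n : (a - b) n = a n - b n. Proof. by []. Qed.

Lemma fps_coef_sum (I : Type) (r : seq I) (P : pred I) (F : I -> fps R) n :
  (\sum_(i <- r | P i) F i) n = \sum_(i <- r | P i) F i n.
Proof. by elim/big_rec2: _ => // i y1 y2 _ <-. Qed.

End Zmod.

Section Ring.
Variable R : comNzRingType.
Implicit Types a b c x : fps R.

Definition fps_one : fps R := FPS (fun n => (n == 0)%:R).
Definition fps_mul a b : fps R :=
  FPS (fun n => \sum_(i < n.+1) a i * b (n - i)%N).

Let trunc m a : {poly R} := \poly_(i < m) a i.

Let fps_mul_trunc a b m n :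
  (n < m)%N -> fps_mul a b n = (trunc m a * trunc m b)`_n.
Proof.
move=> nm; rewrite coefM; apply: eq_bigr => i _; rewrite !coef_poly.
have im : (i < m)%N by apply: leq_ltn_trans nm; rewrite -ltnS.
by rewrite im (leq_ltn_trans (leq_subr _ _) nm).
Qed.

Fact fps_mulC : commutative fps_mul.
Proof.
by move=> a b; apply/fpsP => n; rewrite !(fps_mul_trunc _ _ (ltnSn n)) mulrC.
Qed.

Let fps_mulE3 a b c n : fps_mul a (fps_mul b c) n =
  (trunc n.+1 a * (trunc n.+1 b * trunc n.+1 c))`_n.
Proof.
rewrite coefM; apply: eq_bigr => i _; rewrite coef_poly ltn_ord; congr (_ * _).
by rewrite -fps_mul_trunc // ltnS leq_subr.
Qed.

Fact fps_mulA : associative fps_mul.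
Proof.
move=> a b c; apply/fpsP => n.
rewrite [fps_mul (fps_mul a b) c]fps_mulC !fps_mulE3.
by rewrite mulrA [in RHS]mulrC.
Qed.

Fact fps_mul1 : left_id fps_one fps_mul.
Proof.
move=> a; apply/fpsP => n /=.
rewrite big_ord_recl /= subn0 mul1r big1 ?addr0 // => i _.
by rewrite mul0r.
Qed.

Fact fps_mulDl : left_distributive fps_mul +%R.
Proof.
move=> a b c; apply/fpsP => n /=.
by rewrite -big_split; apply: eq_bigr => i _; rewrite mulrDl.
Qed.

Fact fps_one_neq0 : fps_one != 0.
Proof.
by apply/eqP => /(congr1 (fun a : fps R => a 0%N))/eqP; rewrite oner_eq0.
Qed.

HB.instance Definition _ := GRing.Zmodule_isComNzRing.Build (fps R)
  fps_mulA fps_mulC fps_mul1 fps_mulDl fps_one_neq0.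

Definition fps_X : fps R := FPS (fun n => (n == 1)%:R).

Lemma fps_coef1 n : (1 : fps R) n = (n == 0)%:R. Proof. by []. Qed.
Lemma fps_coefM a b n : (a * b) n = \sum_(i < n.+1) a i * b (n - i)%N.
Proof. by []. Qed.
Lemma fps_coef0M a b : (a * b) 0%N = a 0%N * b 0%N.
Proof. by rewrite fps_coefM big_ord1. Qed.

Lemma fps_coefX_small a k n : a 0%N = 0 -> (n < k)%N -> (a ^+ k) n = 0.
Proof.
move=> a0; elim: k n => // k IH n nk.
rewrite exprS fps_coefM big_ord_recl a0 mul0r add0r big1 // => i _.
by rewrite IH ?mulr0 //= /bump /=; case: n i nk => [[]//|n] i nk; rewrite subSS
  (leq_ltn_trans (leq_subr _ _)).
Qed.

Lemma fps_coefMX_small a b k n :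
  a 0%N = 0 -> (n < k)%N -> (b * a ^+ k) n = 0.
Proof.
move=> a0 nk; rewrite fps_coefM big1 // => i _.
by rewrite fps_coefX_small ?mulr0 // (leq_ltn_trans (leq_subr _ _)).
Qed.

(* (a; x)_oo = prod_(k >= 0) (1 - a x^k), for x without constant term. The
   factors with k > n do not affect the coefficient of q^n, so this is the
   coefficientwise limit of the partial products: see qpoch_lim. *)
Definition qpoch a x : fps R :=
  FPS (fun n => (\prod_(k < n.+1) (1 - a * x ^+ k)) n).

Lemma qpoch_lim a x n m : x 0%N = 0 -> (n < m)%N ->
  (\prod_(k < m) (1 - a * x ^+ k)) n = qpoch a x n.
Proof.
move=> x0; elim: m => // m IH; rewrite ltnS leq_eqVlt => /predU1P[-> //|nm].
have -> : \prod_(k < m.+1) (1 - a * x ^+ k)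
    = \prod_(k < m) (1 - a * x ^+ k) * (1 - a * x ^+ m) by rewrite big_ord_recr.
rewrite mulrBr mulr1 fps_coefB IH //.
by rewrite mulrA fps_coefMX_small // subr0.
Qed.

Definition euler_f (r : nat) : fps R := qpoch (fps_X ^+ r) (fps_X ^+ r).

End Ring.

Section UnitRing.
Variable R : comUnitRingType.
Implicit Types a b x : fps R.

Definition fps_unit : {pred fps R} := fun a => a 0%N \is a GRing.unit.

(* With u := 1 - a / a_0, the inverse is a_0^-1 * sum_k u^k; since u_0 = 0 the
   terms with k > n do not affect the coefficient of q^n. *)
Definition fps_inv a : fps R :=
  if a \in fps_unit then
    let u := 1 - FPS (fun n => (a 0%N)^-1 * a n) in
    FPS (fun n => (a 0%N)^-1 * (\sum_(k < n.+1) u ^+ k) n)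
  else a.

Fact fps_mulV : {in fps_unit, left_inverse 1 fps_inv *%R}.
Proof.
move=> a ua; have ua0 : a 0%N \is a GRing.unit := ua.
rewrite /fps_inv ua; set v := FPS (fun n => (a 0%N)^-1 * a n).
set u := 1 - v.
have u0 : u 0%N = 0 by rewrite fps_coefB /= mulVr // subrr.
have stab n m : (n < m)%N ->
    (\sum_(k < m) u ^+ k) n = (\sum_(k < n.+1) u ^+ k) n.
  elim: m => // m IH; rewrite ltnS leq_eqVlt => /predU1P[-> //|nm].
  have -> : \sum_(k < m.+1) u ^+ k = \sum_(k < m) u ^+ k + u ^+ m.
    by rewrite big_ord_recr.
  by rewrite fps_coefD IH // fps_coefX_small // addr0.
apply/fpsP => n.
have -> : (FPS (fun n => (a 0%N)^-1 * (\sum_(k < n.+1) u ^+ k) n) * a) n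
    = ((\sum_(k < n.+1) u ^+ k) * v) n.
  rewrite !fps_coefM; apply: eq_bigr => i _ /=.
  by rewrite [RHS]mulrCA mulrA (stab i n.+1).
have -> : v = 1 - u by rewrite /u opprB addrC subrK.
rewrite mulrC.
have -> : (1 - u) * \sum_(k < n.+1) u ^+ k = 1 - u ^+ n.+1.
  by rewrite -opprB mulNr -subrX1 opprB.
by rewrite fps_coefB fps_coefX_small // subr0.
Qed.

Fact fps_unitPl a b : b * a = 1 -> a \in fps_unit.
Proof.
move=> /(congr1 (fun c : fps R => c 0%N)); rewrite fps_coef0M fps_coef1 eqxx.
by move=> ba; apply/unitrPr; exists (b 0%N); rewrite mulrC.
Qed.

Fact fps_inv_out : {in [predC fps_unit], fps_inv =1 id}.
Proof. by move=> a; rewrite inE /fps_inv => /negbTE ->. Qed.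

HB.instance Definition _ := GRing.ComNzRing_hasMulInverse.Build (fps R)
  fps_mulV fps_unitPl fps_inv_out.

Lemma fps_unitE a : (a \is a GRing.unit) = (a 0%N \is a GRing.unit).
Proof. by []. Qed.

Lemma qpoch_unit a x : a 0%N = 0 -> qpoch a x \is a GRing.unit.
Proof.
by move=> a0; rewrite fps_unitE /= big_ord1 fps_coefB fps_coef0M a0 mul0r subr0
  unitr1.
Qed.

Lemma euler_f_unit r : (0 < r)%N -> euler_f R r \is a GRing.unit.
Proof. by move=> r0; rewrite qpoch_unit // fps_coefX_small. Qed.

End UnitRing.

Notation "'q" := (fps_X int) : ring_scope.
Notation "''f_' r" := (euler_f int r)
  (at level 8, r at level 2, format "''f_' r") : ring_scope.

(* The number of overpartitions of n of Schur type, valued in int. *)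
Definition overS (n : nat) : int :=
  ((qpoch 'q ('q ^+ 6) * qpoch ('q ^+ 5) ('q ^+ 6)
    * qpoch ('q ^+ 6) ('q ^+ 6))^-1 : fps int) n.

Lemma overS_gf : FPS overS = (qpoch 'q ('q ^+ 6) * qpoch ('q ^+ 5) ('q ^+ 6)
    * qpoch ('q ^+ 6) ('q ^+ 6))^-1.
Proof. exact/fpsP. Qed.

Lemma overS_gf_unit : qpoch 'q ('q ^+ 6) * qpoch ('q ^+ 5) ('q ^+ 6)
    * qpoch ('q ^+ 6) ('q ^+ 6) \is a GRing.unit.
Proof. by rewrite !unitrM !qpoch_unit ?fps_coefX_small. Qed.

(* Main.v *)
From HB Require Import structures.
Require Import Defs.
From mathcomp Require Import all_boot all_order all_algebra.
From mathcomp Require Import zify ring.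

Set Implicit Arguments.
Unset Strict Implicit.
Unset Printing Implicit Defensive.

Import GRing.Theory.
Local Open Scope ring_scope.

(* Let f(a, b) = sum_j a^(j(j+1)/2) b^(j(j-1)/2), over all integers j. By the
   Jacobi triple product sum_n S(n) q^n = 1 / A with A = f(-q, -q^5), and
   separating even from odd j gives A = P(q^4) - q Q(q^4) with P = f(q^2, q^4)
   and Q = f(q, q^5) = A(-q). Summing a geometric progression,
     1 / A = sum_(r < 4) q^r (P^(3-r) Q^r / D)(q^4),   D = P^4 - q Q^4,
   which is the 4-dissection. The triple product turns P and Q into quotients of
   the f_r. So is D: a series a(q^2) - q b(q^2) times its image under q -> -q is
   (a^2 - q b^2)(q^2), so that A(q) A(-q) = B(q^2) with
   B = P(q^2)^2 - q Q(q^2)^2, and B(q) B(-q) = D(q^2), while f_r(-q) is an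
   explicit quotient of the f_r.

   The triple product itself is the limit, modulo each power of q, of its finite
   form with Gaussian binomial coefficients. *)

Section UnitFractions.
Variable S : comUnitRingType.
Implicit Types x y z t : S.

Lemma eqr_div_cross x y z t : y \is a GRing.unit -> t \is a GRing.unit ->
  x * t = z * y -> x / y = z / t.
Proof.
by move=> uy ut e; apply: (mulIr uy); rewrite divrK // mulrAC -e mulrK.
Qed.

Lemma mulr_div_unit x y z t : y \is a GRing.unit -> t \is a GRing.unit ->
  (x / y) * (z / t) = (x * z) / (y * t).
Proof. by move=> uy ut; rewrite invrM // mulrACA [t^-1 * _]mulrC. Qed.

Lemma divr_div_unit x y z t : y \is a GRing.unit -> z \is a GRing.unit ->
  t \is a GRing.unit -> (x / y) / (z / t) = (x * t) / (y * z).
Proof.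
move=> uy uz ut; rewrite -[RHS]mulr_div_unit //.
by rewrite invrM ?unitrV // invrK.
Qed.

End UnitFractions.

Lemma bin2S n : 'C(n.+1, 2) = ('C(n, 2) + n)%N.
Proof. by rewrite binS bin1. Qed.

Lemma bin2_double n : 'C(n.*2, 2) = (4 * 'C(n, 2) + n)%N.
Proof. by elim: n => // n IH; rewrite doubleS !bin2S IH; lia. Qed.

Lemma sum_parity_split (V : nmodType) n (F : nat -> V) :
  \sum_(i < n.*2.+1) F i = \sum_(i < n.+1) F i.*2 + \sum_(i < n) F i.*2.+1.
Proof.
elim: n => [|n IH]; first by rewrite !big_ord_recr !big_ord0 addr0.
rewrite doubleS 2!big_ord_recr IH [X in _ = X + _]big_ord_recr.
by rewrite [X in _ = _ + X]big_ord_recr /= [RHS]addrACA -addrA [F _ + _]addrC.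
Qed.

Section Algebra.
Variable R : comNzRingType.
Implicit Types a b : fps R.

Definition fps_scale (c : R) a : fps R := FPS (fun n => c * a n).

Fact fps_scaleA c d a : fps_scale c (fps_scale d a) = fps_scale (c * d) a.
Proof. by apply/fpsP => n /=; rewrite mulrA. Qed.
Fact fps_scale1 : left_id 1 fps_scale.
Proof. by move=> a; apply/fpsP => n /=; rewrite mul1r. Qed.
Fact fps_scaleDr : right_distributive fps_scale +%R.
Proof. by move=> c a b; apply/fpsP => n /=; rewrite mulrDr. Qed.
Fact fps_scaleDl a : {morph fps_scale^~ a : c d / c + d}.
Proof. by move=> c d; apply/fpsP => n /=; rewrite mulrDl. Qed.

HB.instance Definition _ := GRing.Zmodule_isLmodule.Build R (fps R)
  fps_scaleA fps_scale1 fps_scaleDr fps_scaleDl.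

Fact fps_scaleAl (c : R) a b : c *: (a * b) = (c *: a) * b.
Proof.
by apply/fpsP => n /=; rewrite mulr_sumr; apply: eq_bigr => i _; rewrite mulrA.
Qed.

HB.instance Definition _ :=
  GRing.Lmodule_isLalgebra.Build R (fps R) fps_scaleAl.
HB.instance Definition _ := GRing.Lalgebra_isComAlgebra.Build R (fps R).

Lemma fps_coefZ c a n : (c *: a) n = c * a n. Proof. by []. Qed.

Lemma fps_coefXM a n : (fps_X R * a) n = if n == 0%N then 0 else a n.-1.
Proof.
rewrite fps_coefM big_ord_recl mul0r add0r; case: n => [|n].
  by rewrite big_ord0.
rewrite big_ord_recl mul1r big1 ?addr0 ?subSS ?subn0 // => i _.
by rewrite mul0r.
Qed.

Lemma fps_coefXnM m a n :
  (fps_X R ^+ m * a) n = if (n < m)%N then 0 else a (n - m)%N.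
Proof.
elim: m a n => [|m IH] a n; first by rewrite mul1r subn0.
rewrite exprSr -mulrA IH fps_coefXM subn_eq0 ltnS subnS.
by case: ltngtP.
Qed.

Lemma fps_coefXn m n : (fps_X R ^+ m) n = (n == m)%:R.
Proof.
rewrite -[fps_X R ^+ m]mulr1 fps_coefXnM fps_coef1.
by rewrite subn_eq0 eqn_leq; case: leqP; rewrite ?andbF ?andbT.
Qed.

Lemma fps_Xn0 m : (0 < m)%N -> (fps_X R ^+ m) 0%N = 0.
Proof. exact: fps_coefX_small. Qed.

Lemma fps_NX0 : (- fps_X R) 0%N = 0.
Proof. by rewrite fps_coefN /= oppr0. Qed.

End Algebra.

Section Congruence.
Variable R : comNzRingType.
Implicit Types a b c d : fps R.

Definition eqmodX N a b := forall n, (n < N)%N -> a n = b n.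

Lemma eqmodX_all a b : (forall N, eqmodX N a b) -> a = b.
Proof. by move=> ab; apply/fpsP => n; exact: (ab n.+1). Qed.

Lemma eqmodX_sym N a b : eqmodX N a b -> eqmodX N b a.
Proof. by move=> ab n nN; rewrite ab. Qed.

Lemma eqmodX_trans N b a c : eqmodX N a b -> eqmodX N b c -> eqmodX N a c.
Proof. by move=> ab bc n nN; rewrite ab ?bc. Qed.

Lemma eqmodXD N a b c d :
  eqmodX N a b -> eqmodX N c d -> eqmodX N (a + c) (b + d).
Proof. by move=> ab cd n nN; rewrite !fps_coefD ab ?cd. Qed.

Lemma eqmodXM N a b c d :
  eqmodX N a b -> eqmodX N c d -> eqmodX N (a * c) (b * d).
Proof.
move=> ab cd n nN; rewrite !fps_coefM; apply: eq_bigr => i _.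
by rewrite ab ?cd //; move: (ltn_ord i); lia.
Qed.

Lemma eqmodX_sum N (I : Type) (r : seq I) (P : pred I) (F G : I -> fps R) :
  (forall i, P i -> eqmodX N (F i) (G i)) ->
  eqmodX N (\sum_(i <- r | P i) F i) (\sum_(i <- r | P i) G i).
Proof. by move=> FG; elim/big_ind2: _ => // a b c d; exact: eqmodXD. Qed.

Lemma eqmodX_prod N (I : Type) (r : seq I) (P : pred I) (F G : I -> fps R) :
  (forall i, P i -> eqmodX N (F i) (G i)) ->
  eqmodX N (\prod_(i <- r | P i) F i) (\prod_(i <- r | P i) G i).
Proof. by move=> FG; elim/big_ind2: _ => // a b c d; exact: eqmodXM. Qed.

Lemma eqmodX_expand N a : eqmodX N a (\sum_(k < N) a k *: fps_X R ^+ k).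
Proof.
move=> n nN; rewrite fps_coef_sum (bigD1 (Ordinal nN)) //=.
rewrite fps_coefXn eqxx mulr1 big1 ?addr0 // => i; rewrite -val_eqE /= => neq.
by rewrite fps_coefXn eq_sym (negbTE neq) mulr0.
Qed.

End Congruence.

(* Sealed: failing unification problems would otherwise unfold the products down
   to their coefficients. *)
HB.lock Definition pochhammer (R : comNzRingType) (a x : fps R) : fps R :=
  qpoch a x.

Section Pochhammer.
Variable R : comNzRingType.
Implicit Types a x : fps R.

Lemma eqmodX_pochhammer N M a x : x 0%N = 0 -> (N <= M)%N ->
  eqmodX N (pochhammer a x) (\prod_(k < M) (1 - a * x ^+ k)).
Proof.
by move=> x0 NM n nN; rewrite pochhammer.unlock qpoch_lim // (leq_trans nN).
Qed.

Lemma pochhammer_split m a x : (0 < m)%N -> x 0%N = 0 ->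
  pochhammer a x = \prod_(j < m) pochhammer (a * x ^+ j) (x ^+ m).
Proof.
move=> m0 x0; apply: eqmodX_all => N.
apply: eqmodX_trans (eqmodX_pochhammer a x0 (leq_pmull N m0)) _.
have -> : \prod_(k < m * N) (1 - a * x ^+ k)
    = \prod_(j < m) \prod_(k < N) (1 - a * x ^+ j * (x ^+ m) ^+ k).
  elim: (N) => [|M IH].
    by rewrite muln0 big_ord0 big1 // => j _; rewrite big_ord0.
  rewrite mulnS addnC big_split_ord /= IH -big_split /=.
  apply: eq_bigr => j _; rewrite big_ord_recr /=; congr (_ * (1 - _)).
  by rewrite exprD -exprM mulrA mulrAC.
apply: eqmodX_prod => j _; apply/eqmodX_sym/eqmodX_pochhammer => //.
by rewrite fps_coefX_small.
Qed.

Lemma pochhammer_split2 a x : x 0%N = 0 ->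
  pochhammer a x = pochhammer a (x ^+ 2) * pochhammer (a * x) (x ^+ 2).
Proof.
move=> /(@pochhammer_split 2 a x isT) ->.
by rewrite big_ord_recl big_ord1 mulr1.
Qed.

Lemma pochhammer_mulN a x : x 0%N = 0 ->
  pochhammer a x * pochhammer (- a) x = pochhammer (a ^+ 2) (x ^+ 2).
Proof.
move=> x0; apply: eqmodX_all => N; have xN := eqmodX_pochhammer _ x0 (leqnn N).
apply: eqmodX_trans (eqmodXM (xN _) (xN _)) _; rewrite -big_split /=.
under eq_bigr => k _ do
  rewrite mulNr opprK -subr_sqr expr1n exprMn -exprM mulnC exprM.
by apply/eqmodX_sym/eqmodX_pochhammer; rewrite // fps_coefX_small.
Qed.

Lemma pochhammer_mul_negX x : x 0%N = 0 ->
  pochhammer x x * pochhammer (- x) (- x) * pochhammer (x ^+ 4) (x ^+ 4)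
  = pochhammer (x ^+ 2) (x ^+ 2) ^+ 3.
Proof.
move=> x0; have x20 : (x ^+ 2) 0%N = 0 by rewrite fps_coefX_small.
have split_diag (y : fps R) : y 0%N = 0 ->
    pochhammer y y = pochhammer y (y ^+ 2) * pochhammer (y ^+ 2) (y ^+ 2).
  by move=> /(pochhammer_split2 y); rewrite -expr2.
have mulN : pochhammer x (x ^+ 2) * pochhammer (- x) (x ^+ 2)
    = pochhammer (x ^+ 2) (x ^+ 4) by rewrite pochhammer_mulN // -exprM.
have x2E : pochhammer (x ^+ 2) (x ^+ 2)
    = pochhammer x (x ^+ 2) * pochhammer (- x) (x ^+ 2)
      * pochhammer (x ^+ 4) (x ^+ 4) by rewrite mulN split_diag // -exprM.
rewrite (split_diag x) // (split_diag (- x)) ?fps_coefN ?x0 ?oppr0 // sqrrN.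
by rewrite [RHS]exprS [X in _ = X * _]x2E; ring.
Qed.

End Pochhammer.

Section Substitution.
Variable R : comNzRingType.
Implicit Types a b x y : fps R.

Definition fps_nilpart x : fps R := x - (x 0%N)%:A.

Lemma fps_nilpart0 x : fps_nilpart x 0%N = 0.
Proof. by rewrite fps_coefB fps_coefZ mulr1 subrr. Qed.

Lemma fps_nilpart_id x : x 0%N = 0 -> fps_nilpart x = x.
Proof. by move=> x0; rewrite /fps_nilpart x0 scale0r subr0. Qed.

(* a(x - x_0): dropping the constant term of x makes the substitution total, and
   always a ring morphism. The terms with k > n do not affect the coefficient of
   q^n. *)
Definition fps_comp x a : fps R :=
  FPS (fun n => \sum_(k < n.+1) a k * (fps_nilpart x ^+ k) n).

Lemma eqmodX_comp N x a b :
  eqmodX N a b -> eqmodX N (fps_comp x a) (fps_comp x b).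
Proof.
move=> ab n nN; apply: eq_bigr => i _; rewrite ab //.
by apply: leq_trans nN; rewrite ltn_ord.
Qed.

Fact fps_comp_is_linear x : linear (fps_comp x).
Proof.
move=> c a b; apply/fpsP => n /=; rewrite mulr_sumr -big_split /=.
by apply: eq_bigr => i _; rewrite mulrDl mulrA.
Qed.

HB.instance Definition _ x :=
  GRing.isLinear.Build R (fps R) (fps R) *:%R (fps_comp x)
    (fps_comp_is_linear x).

Let fps_comp_Xn_nilpart x k : fps_comp x (fps_X R ^+ k) = fps_nilpart x ^+ k.
Proof.
apply/fpsP => n /=; under eq_bigr do rewrite fps_coefXn mulr_natl.
have [kn|nk] := ltnP k n.+1; last first.
  rewrite fps_coefX_small ?fps_nilpart0 // big1 // => i _.
  by rewrite eqn_leq (leqNgt k) (leq_trans (ltn_ord i) nk) andbF.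
rewrite (bigD1 (Ordinal kn)) //= eqxx big1 ?addr0 // => i.
by rewrite -val_eqE /= => /negbTE ->.
Qed.

Let eqmodX_comp_sum N x a :
  eqmodX N (fps_comp x a) (\sum_(k < N) a k *: fps_nilpart x ^+ k).
Proof.
apply: eqmodX_trans (eqmodX_comp x (eqmodX_expand a)) _.
rewrite linear_sum; apply: eqmodX_sum => k _.
by rewrite linearZ /= fps_comp_Xn_nilpart.
Qed.

Fact fps_comp_is_monoid_morphism x : monoid_morphism (fps_comp x).
Proof.
split=> [|a b]; first by rewrite -(expr0 (fps_X R)) fps_comp_Xn_nilpart.
apply: eqmodX_all => N; set T := fun a y => \sum_(k < N) a k *: y ^+ k.
have TX c : eqmodX N c (T c (fps_X R)) := eqmodX_expand c.
apply: eqmodX_trans (eqmodX_comp x (eqmodXM (TX a) (TX b))) _.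
apply/eqmodX_sym; apply: eqmodX_trans (eqmodXM (eqmodX_comp_sum _ _)
  (eqmodX_comp_sum _ _)) _.
have TM y : T a y * T b y
    = \sum_(i < N) \sum_(j < N) (a i * b j) *: y ^+ (i + j).
  rewrite /T big_distrlr /=; apply: eq_bigr => i _; apply: eq_bigr => j _.
  by rewrite -scalerAl -scalerAr scalerA exprD.
rewrite !TM linear_sum; apply: eqmodX_sum => i _.
rewrite linear_sum; apply: eqmodX_sum => j _.
by rewrite linearZ /= fps_comp_Xn_nilpart.
Qed.

HB.instance Definition _ x :=
  GRing.isMonoidMorphism.Build (fps R) (fps R) (fps_comp x)
    (fps_comp_is_monoid_morphism x).

Lemma fps_compX x : x 0%N = 0 -> fps_comp x (fps_X R) = x.
Proof.
by move=> x0; rewrite -[fps_X R]expr1 fps_comp_Xn_nilpart fps_nilpart_id.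
Qed.

Lemma fps_comp_coef0 x a : fps_comp x a 0%N = a 0%N.
Proof. by rewrite /= big_ord1 fps_coef1 mulr1. Qed.

Lemma fps_comp_comp x y a : x 0%N = 0 -> y 0%N = 0 ->
  fps_comp x (fps_comp y a) = fps_comp (fps_comp x y) a.
Proof.
move=> x0 y0; apply: eqmodX_all => N.
apply: eqmodX_trans (eqmodX_comp x (eqmodX_comp_sum y a)) _.
apply: eqmodX_sym; apply: eqmodX_trans (eqmodX_comp_sum _ _) _.
rewrite !fps_nilpart_id ?fps_comp_coef0 // linear_sum; apply: eqmodX_sum => k _.
by rewrite linearZ /= rmorphXn.
Qed.

Lemma fps_coef_comp_Xn k a n : (0 < k)%N ->
  fps_comp (fps_X R ^+ k) a n = if (k %| n)%N then a (n %/ k)%N else 0.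
Proof.
move=> k0 /=; rewrite fps_nilpart_id ?fps_Xn0 //.
under eq_bigr do rewrite -exprM fps_coefXn mulr_natr mulrb.
rewrite -big_mkcond /=.
case: ifP => [/dvdnP[m ->] | /negP ndvd]; last first.
  rewrite big_pred0 // => i; apply/eqP => nE.
  by apply: ndvd; rewrite nE dvdn_mulr.
have mk : (m < (m * k).+1)%N by rewrite ltnS leq_pmulr.
rewrite mulnK // (big_pred1 (Ordinal mk)) // => i.
by rewrite /= -val_eqE /= [(k * i)%N]mulnC eqn_pmul2r // eq_sym.
Qed.

Lemma fps_comp_Xn_inj k : (0 < k)%N -> injective (fps_comp (fps_X R ^+ k)).
Proof.
move=> k0 a b /(congr1 (fun c : fps R => c _)) ab; apply/fpsP => n.
by have := ab (k * n)%N; rewrite !fps_coef_comp_Xn // dvdn_mulr // mulKn.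
Qed.

Lemma fps_comp_pochhammer x a y : y 0%N = 0 ->
  fps_comp x (pochhammer a y) = pochhammer (fps_comp x a) (fps_comp x y).
Proof.
move=> y0; apply: eqmodX_all => N.
apply: eqmodX_trans (eqmodX_comp x (eqmodX_pochhammer _ y0 (leqnn N))) _.
rewrite rmorph_prod; under eq_bigr do rewrite rmorphB rmorph1 rmorphM rmorphXn.
by apply/eqmodX_sym/eqmodX_pochhammer; rewrite ?fps_comp_coef0.
Qed.

Lemma fps_coef_multisection k (c : nat -> fps R) s n : (s < k)%N ->
  (\sum_(r < k) fps_X R ^+ r * fps_comp (fps_X R ^+ k) (c r)) (k * n + s)%N
  = c s n.
Proof.
move=> sk; have k0 : (0 < k)%N by apply: leq_trans sk.
rewrite fps_coef_sum (bigD1 (Ordinal sk)) // big1 => [|r].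
  rewrite [LHS]addr0 fps_coefXnM ltnNge leq_addl addnK fps_coef_comp_Xn //.
  by rewrite dvdn_mulr // mulKn.
rewrite -val_eqE fps_coefXnM fps_coef_comp_Xn //= => /eqP rs.
case: leqP => // rkn; case: ifP => // /dvdnP[m kE]; case: rs.
have := congr1 (modn^~ k) (subnK rkn).
by rewrite /= kE modnMDl mulnC modnMDl !modn_small.
Qed.

End Substitution.

Section GaussianBinomial.
Variables (R : comNzRingType) (x : R).

Fixpoint qbin n k : R :=
  match n, k with
  | _, 0 => 1
  | 0, _.+1 => 0
  | n'.+1, k'.+1 => qbin n' k' + x ^+ k * qbin n' k
  end.

Lemma qbin0 n : qbin n 0 = 1. Proof. by case: n. Qed.

Lemma qbinS n k : qbin n.+1 k.+1 = qbin n k + x ^+ k.+1 * qbin n k.+1.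
Proof. by []. Qed.

Lemma qbin_small n k : (n < k)%N -> qbin n k = 0.
Proof.
by elim: n k => [|n IH] [|k] //= nk; rewrite !IH ?mulr0 ?addr0 // ltnW.
Qed.

Lemma sum_qbinS n (F : nat -> R) :
  \sum_(i < n.+2) qbin n.+1 i * F i
  = \sum_(i < n.+1) qbin n i * (F i.+1 + x ^+ i * F i).
Proof.
rewrite big_ord_recl qbin0; under eq_bigr do rewrite lift0 qbinS mulrDl.
under [RHS]eq_bigr do rewrite mulrDr; rewrite !big_split addrCA; congr (_ + _).
rewrite big_ord_recr [in RHS]big_ord_recl /= qbin_small // qbin0.
rewrite mulr0 mul0r addr0 expr0 !mul1r; congr (_ + _).
by apply: eq_bigr => i _; rewrite mulrCA mulrA.
Qed.

Definition qfact n : R := \prod_(k < n) (1 - x ^+ k.+1).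

Lemma qfact0 : qfact 0 = 1. Proof. exact: big_ord0. Qed.

Lemma qfactS n : qfact n.+1 = qfact n * (1 - x ^+ n.+1).
Proof. by rewrite /qfact big_ord_recr. Qed.

Lemma qbin_qfact k l : qbin (k + l) k * (qfact k * qfact l) = qfact (k + l).
Proof.
elim: k l => [|k IHk] l; first by rewrite qbin0 qfact0 !mul1r.
elim: l => [|l IHl].
  have := IHk 0%N; rewrite !addn0 qbinS (@qbin_small k k.+1) // mulr0 addr0.
  by rewrite qfact0 !mulr1 qfactS mulrA => ->.
transitivity (qbin (k + l.+1) k * (qfact k * qfact l.+1) * (1 - x ^+ k.+1)
    + x ^+ k.+1 * (1 - x ^+ l.+1)
      * (qbin (k.+1 + l) k.+1 * (qfact k.+1 * qfact l))).
  by rewrite addSn qbinS !qfactS addSnnS; ring.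
rewrite IHk IHl addSnnS addSn [in RHS]qfactS -addSn exprD; ring.
Qed.

End GaussianBinomial.

Arguments qbin : simpl never.

Theorem qbinomial_theorem (R : comNzRingType) (x a : R) n :
  \prod_(k < n) (1 + a * x ^+ k)
  = \sum_(i < n.+1) qbin x n i * (a ^+ i * x ^+ 'C(i, 2)).
Proof.
elim: n a => [|n IH] a; first by rewrite big_ord0 big_ord1 !mul1r.
rewrite big_ord_recl expr0 mulr1; under eq_bigr do rewrite lift0 exprS mulrA.
rewrite IH mulr_sumr [RHS](sum_qbinS x n (fun i => a ^+ i * x ^+ 'C(i, 2))).
by apply: eq_bigr => i _; rewrite bin2S exprD exprS exprMn; ring.
Qed.

Section FiniteTripleProduct.
Variable R : comNzRingType.
Implicit Types a b c : R.

(* With j = i - n this is a^(j(j+1)/2) b^(j(j-1)/2): for each sign of j the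
   truncated subtractions kill the unwanted binomials. *)
Definition theta_term a b i n : R :=
  a ^+ ('C((i - n).+1, 2) + 'C(n - i, 2))
  * b ^+ ('C(i - n, 2) + 'C((n - i).+1, 2)).

Lemma theta_termDl a b k n :
  theta_term a b (k + n) n = a ^+ 'C(k.+1, 2) * b ^+ 'C(k, 2).
Proof. by rewrite /theta_term addnK (eqP (leq_addl k n)) !addn0. Qed.

Lemma theta_termDr a b k i :
  theta_term a b i (k + i) = a ^+ 'C(k, 2) * b ^+ 'C(k.+1, 2).
Proof. by rewrite /theta_term addnK (eqP (leq_addl k i)) !add0n. Qed.

Lemma theta_termSS a b i n : theta_term a b i.+1 n.+1 = theta_term a b i n.
Proof. by rewrite /theta_term !subSS. Qed.

Lemma theta_term_geom a b i n :
  b * (a * b) ^+ n * theta_term a b i n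
  = (a * b) ^+ i * theta_term a b i n.+1.
Proof.
have [/subnK <-|/subnK <-] := leqP i n.
  by rewrite -addSn !theta_termDr !bin2S !(exprS, exprD, exprMn); ring.
rewrite theta_termDl addnS -addSn theta_termDl addSn.
by rewrite !bin2S !(exprS, exprD, exprMn); ring.
Qed.

Theorem finite_triple_product a b m n :
  \prod_(k < m) (1 + a * (a * b) ^+ k) * \prod_(k < n) (1 + b * (a * b) ^+ k)
  = \sum_(i < (m + n).+1) qbin (a * b) (m + n) i * theta_term a b i n.
Proof.
elim: n => [|n IH].
  rewrite big_ord0 mulr1 addn0 qbinomial_theorem; apply: eq_bigr => i _.
  rewrite -[X in theta_term _ _ X]addn0 theta_termDl bin2S exprD exprMn.
  by ring.
rewrite big_ord_recr mulrA IH mulr_suml addnS.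
rewrite (sum_qbinS _ _ (theta_term a b ^~ n.+1)); apply: eq_bigr => i _.
by rewrite -theta_term_geom theta_termSS; ring.
Qed.

Lemma theta_term_even a b i n :
  theta_term a b i.*2 n.*2 = theta_term (a ^+ 3 * b) (a * b ^+ 3) i n.
Proof.
have powE k l : (a ^+ 3 * b) ^+ k * (a * b ^+ 3) ^+ l
    = a ^+ (3 * k + l) * b ^+ (k + 3 * l).
  by rewrite [(_ * b) ^+ k]exprMn [(a * _) ^+ l]exprMn -!exprM !exprD; ring.
have [/subnK <-|/ltnW/subnK <-] := leqP i n; rewrite doubleD.
  rewrite !theta_termDr powE !bin2S !bin2_double.
  by congr (_ ^+ _ * _ ^+ _); lia.
rewrite !theta_termDl powE !bin2S !bin2_double.
by congr (_ ^+ _ * _ ^+ _); lia.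
Qed.

Lemma theta_term_odd a c i n :
  theta_term a (a * c) i.*2.+1 n.*2 = a * theta_term (a ^+ 8 * c ^+ 3) c i n.
Proof.
have powlE k l : a ^+ k * (a * c) ^+ l = a ^+ (k + l) * c ^+ l.
  by rewrite exprMn mulrA exprD.
have powrE k l : a * ((a ^+ 8 * c ^+ 3) ^+ k * c ^+ l)
    = a ^+ (8 * k).+1 * c ^+ (3 * k + l).
  by rewrite [(_ * c ^+ 3) ^+ k]exprMn -!exprM exprS exprD; ring.
have [/subnK <-|/subnK <-] := leqP n i.
  rewrite doubleD -addSn !theta_termDl powlE powrE !bin2S !bin2_double.
  by congr (_ ^+ _ * _ ^+ _); lia.
rewrite addnS -addSn.
have -> k : (k.+1 + i).*2 = (k.*2.+1 + i.*2.+1)%N by lia.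
rewrite !theta_termDr powlE powrE !bin2S !bin2_double.
by congr (_ ^+ _ * _ ^+ _); lia.
Qed.

End FiniteTripleProduct.

Section TripleProduct.
Variable R : comUnitRingType.
Implicit Types a b c x : fps R.

Lemma pochhammer_unit a x : a 0%N = 0 -> pochhammer a x \is a GRing.unit.
Proof. by rewrite pochhammer.unlock; exact: qpoch_unit. Qed.

Lemma eqmodX_qfact N n x : x 0%N = 0 -> (N <= n)%N ->
  eqmodX N (qfact x n) (pochhammer x x).
Proof.
move=> x0 Nn; rewrite /qfact; under eq_bigr do rewrite exprS.
exact/eqmodX_sym/eqmodX_pochhammer.
Qed.

Lemma eqmodX_qbin N k l x : x 0%N = 0 -> (N <= k)%N -> (N <= l)%N ->
  eqmodX N (qbin x (k + l) k) (pochhammer x x)^-1.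
Proof.
move=> x0 Nk Nl; set p := pochhammer x x.
have up : p \is a GRing.unit by apply: pochhammer_unit.
have qfactE n : (N <= n)%N -> eqmodX N (qfact x n) p by apply: eqmodX_qfact.
have qbinE : eqmodX N (qbin x (k + l) k * (p * p)) p.
  apply: eqmodX_trans (qfactE _ (leq_trans Nk (leq_addr l k))).
  rewrite -qbin_qfact; apply: eqmodXM => //.
  by apply: eqmodXM; apply/eqmodX_sym/qfactE.
have upp : p * p \is a GRing.unit by rewrite unitrM up.
have -> : p^-1 = p / (p * p) by rewrite invrM // mulVKr.
by rewrite -[qbin x _ _](mulrK upp); apply: eqmodXM.
Qed.

Lemma eqmodX_theta_term0 N i n a b : a 0%N = 0 -> b 0%N = 0 ->
  (i + N <= n)%N || (n + N <= i)%N -> eqmodX N (theta_term a b i n) 0.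
Proof.
move=> a0 b0 far m mN; have [le_in|lt_ni] := leqP i n.
  by rewrite -(subnK le_in) theta_termDr bin2S fps_coefMX_small //; lia.
rewrite -(subnK (ltnW lt_ni)) theta_termDl bin2S mulrC.
by rewrite fps_coefMX_small //; lia.
Qed.

(* Ramanujan's f(a, b) = sum_j a^(j(j+1)/2) b^(j(j-1)/2), in product form. *)
Definition ramanujan_theta a b : fps R :=
  pochhammer (- a) (a * b) * pochhammer (- b) (a * b)
  * pochhammer (a * b) (a * b).

Lemma ramanujan_thetaC a b : ramanujan_theta a b = ramanujan_theta b a.
Proof. by rewrite /ramanujan_theta [b * a]mulrC [X in X * _]mulrC. Qed.

Theorem jacobi_triple_product N n a b :
  a 0%N = 0 -> b 0%N = 0 -> (N + N <= n)%N ->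
  eqmodX N (ramanujan_theta a b) (\sum_(i < (n + n).+1) theta_term a b i n).
Proof.
move=> a0 b0 Nn; have x0 : (a * b) 0%N = 0 by rewrite fps_coef0M a0 mul0r.
set p := pochhammer (a * b) (a * b).
have up : p \is a GRing.unit by apply: pochhammer_unit.
have prodE c : eqmodX N (pochhammer (- c) (a * b))
    (\prod_(k < n) (1 + c * (a * b) ^+ k)).
  have <- : \prod_(k < n) (1 - - c * (a * b) ^+ k)
      = \prod_(k < n) (1 + c * (a * b) ^+ k).
    by apply: eq_bigr => k _; rewrite mulNr opprK.
  by apply: eqmodX_pochhammer => //; lia.
apply: (@eqmodX_trans _ _
  ((\sum_(i < (n + n).+1) qbin (a * b) (n + n) i * theta_term a b i n) * p)).
  by rewrite -finite_triple_product; apply: eqmodXM => //; apply: eqmodXM.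
rewrite mulr_suml; apply: eqmodX_sum => -[i /= i2n] _; rewrite mulrAC.
have [far|near] := boolP ((i + N <= n)%N || (n + N <= i)%N).
  have term0 := eqmodX_theta_term0 a0 b0 far.
  apply: eqmodX_trans (eqmodX_sym term0).
  rewrite -[X in eqmodX N _ X](mulr0 (qbin (a * b) (n + n) i * p)).
  exact: eqmodXM.
rewrite -[X in eqmodX N _ X]mul1r -(mulVr up); apply: eqmodXM => //.
apply: eqmodXM => //; have -> : (n + n = i + (n + n - i))%N by lia.
by apply: eqmodX_qbin => //; lia.
Qed.

(* f(a, b) = f(a^3 b, a b^3) + a f(a^5 b^3, b / a), with b = a c since a is not
   a unit. *)
Lemma ramanujan_theta_dissect a c : a 0%N = 0 -> c 0%N = 0 ->
  ramanujan_theta a (a * c)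
  = ramanujan_theta (a ^+ 3 * (a * c)) (a * (a * c) ^+ 3)
    + a * ramanujan_theta (a ^+ 8 * c ^+ 3) c.
Proof.
move=> a0 c0; apply: eqmodX_all => N; pose n := (N + N).+1.
have M0 x y : x 0%N = 0 -> (x * y) 0%N = 0.
  by move=> x0; rewrite fps_coef0M x0 mul0r.
have X0 x k : x 0%N = 0 -> (x ^+ k.+1) 0%N = 0 by move=> x0; rewrite exprS M0.
apply: eqmodX_trans (jacobi_triple_product (n := n.*2) _ _ _) _.
- exact: a0.
- exact: M0.
- by rewrite /n; lia.
rewrite addnn (sum_parity_split _ (theta_term a (a * c) ^~ n.*2)).
under eq_bigr do rewrite theta_term_even.
under [X in _ + X]eq_bigr do rewrite theta_term_odd.
rewrite -addnn -mulr_sumr; apply: eqmodXD.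
  by apply/eqmodX_sym/jacobi_triple_product; rewrite ?M0 ?X0 // /n; lia.
apply: eqmodXM => //; apply: eqmodX_sym.
apply: eqmodX_trans (jacobi_triple_product (n := n) _ _ _) _.
- by rewrite M0 ?X0.
- exact: c0.
- by rewrite /n; lia.
rewrite big_ord_recr -[X in eqmodX N _ X]addr0; apply: eqmodXD => //.
by apply: eqmodX_theta_term0; rewrite ?M0 ?X0 //= /n; lia.
Qed.

Lemma fps_comp_ramanujan_theta x a b : a 0%N = 0 ->
  fps_comp x (ramanujan_theta a b)
  = ramanujan_theta (fps_comp x a) (fps_comp x b).
Proof.
move=> a0; have ab0 : (a * b) 0%N = 0 by rewrite fps_coef0M a0 mul0r.
by rewrite !rmorphM /= !fps_comp_pochhammer // !rmorphN !rmorphM.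
Qed.

End TripleProduct.

Section EulerProducts.
Variable R : comUnitRingType.
Local Notation X := (fps_X R).
Local Notation neg := (fps_comp (- X)).

Definition euler r : fps R := pochhammer (X ^+ r) (X ^+ r).
Local Notation f := euler.

Lemma euler_fE r : euler_f R r = f r.
Proof. by rewrite /euler pochhammer.unlock. Qed.

Lemma euler_unit r : (0 < r)%N -> f r \is a GRing.unit.
Proof. by move=> r0; rewrite pochhammer_unit ?fps_Xn0. Qed.

Lemma euler_split m r : (0 < m)%N -> (0 < r)%N ->
  f r = \prod_(j < m) pochhammer (X ^+ (r * j.+1)) (X ^+ (r * m)).
Proof.
move=> m0 r0; rewrite /euler (pochhammer_split _ m0) ?fps_Xn0 // exprM.
by apply: eq_bigr => j _; rewrite -exprM -exprD -mulnS.
Qed.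

Lemma fps_comp_Xn k m : (0 < k)%N -> fps_comp (X ^+ k) (X ^+ m) = X ^+ (k * m).
Proof. by move=> k0; rewrite rmorphXn /= fps_compX ?fps_Xn0 // -exprM. Qed.

Lemma fps_comp_NXn m : neg (X ^+ m) = (- X) ^+ m.
Proof. by rewrite rmorphXn /= fps_compX ?fps_NX0. Qed.

Lemma fps_comp_Xn_euler k r : (0 < k)%N -> (0 < r)%N ->
  fps_comp (X ^+ k) (f r) = f (k * r).
Proof.
by move=> k0 r0; rewrite fps_comp_pochhammer ?fps_Xn0 ?fps_comp_Xn.
Qed.

Lemma fps_comp_NX_euler_even r : (0 < r)%N -> neg (f r.*2) = f r.*2.
Proof.
move=> r0; rewrite /euler fps_comp_pochhammer ?fps_Xn0 ?double_gt0 //.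
by rewrite fps_comp_NXn -mul2n exprM sqrrN -exprM.
Qed.

Lemma fps_comp_NX_euler_odd r : odd r ->
  neg (f r) * (f r * f (r * 4)) = f (r * 2) ^+ 3.
Proof.
move=> r_odd; have Xr0 : (X ^+ r) 0%N = 0 by rewrite fps_Xn0 // odd_gt0.
rewrite /euler fps_comp_pochhammer // fps_comp_NXn.
rewrite exprNn -signr_odd r_odd mulN1r.
by rewrite !exprM -(pochhammer_mul_negX Xr0) mulrA [X in X * _]mulrC.
Qed.

End EulerProducts.

Lemma ramanujan_theta_dissect_1_5 (R : comUnitRingType) (x : fps R) :
  x 0%N = 0 ->
  ramanujan_theta (- x) (- x ^+ 5)
  = ramanujan_theta (x ^+ 8) (x ^+ 16) - x * ramanujan_theta (x ^+ 4) (x ^+ 20).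
Proof.
move=> x0; have nx0 : (- x) 0%N = 0 by rewrite fps_coefN x0 oppr0.
have x40 : (x ^+ 4) 0%N = 0 by rewrite fps_coefX_small.
have := ramanujan_theta_dissect nx0 x40.
rewrite [ramanujan_theta _ (x ^+ 4)]ramanujan_thetaC.
rewrite [- x * ramanujan_theta _ _]mulNr.
have -> : - x * x ^+ 4 = - x ^+ 5 by ring.
have -> : (- x) ^+ 3 * - x ^+ 5 = x ^+ 8 by ring.
have -> : - x * (- x ^+ 5) ^+ 3 = x ^+ 16 by ring.
by have -> : (- x) ^+ 8 * (x ^+ 4) ^+ 3 = x ^+ 20 by ring.
Qed.

Section SchurTheta.
Variable R : comUnitRingType.
Local Notation X := (fps_X R).
Local Notation f := (euler R).
Local Notation neg := (fps_comp (- X)).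

Definition schur_theta : fps R := ramanujan_theta (- X) (- X ^+ 5).
Definition theta24 : fps R := ramanujan_theta (X ^+ 2) (X ^+ 4).
Definition theta15 : fps R := ramanujan_theta X (X ^+ 5).

Lemma schur_theta_qpoch : schur_theta
  = qpoch X (X ^+ 6) * qpoch (X ^+ 5) (X ^+ 6) * qpoch (X ^+ 6) (X ^+ 6).
Proof.
by rewrite /schur_theta /ramanujan_theta !opprK mulrNN -exprS pochhammer.unlock.
Qed.

Lemma schur_theta_dissect : schur_theta
  = fps_comp (X ^+ 4) theta24 - X * fps_comp (X ^+ 4) theta15.
Proof.
rewrite !fps_comp_ramanujan_theta ?fps_Xn0 //.
rewrite !fps_comp_Xn // fps_compX ?fps_Xn0 //.
exact: ramanujan_theta_dissect_1_5.
Qed.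

Lemma fps_comp_NX_schur_theta : neg schur_theta = theta15.
Proof.
rewrite /schur_theta fps_comp_ramanujan_theta ?fps_NX0 // !rmorphN /=.
rewrite fps_comp_NXn fps_compX ?fps_NX0 // exprNn -signr_odd.
by rewrite opprK mulN1r opprK.
Qed.

Lemma schur_theta_euler : schur_theta = f 1 * f 6 ^+ 2 / (f 2 * f 3).
Proof.
apply: canRL (mulrK _) _; first by rewrite unitrM !euler_unit.
rewrite (@euler_split R 6 1) // (@euler_split R 3 2) //.
rewrite (@euler_split R 2 3) // !big_ord_recl !big_ord0 /=.
rewrite /schur_theta /ramanujan_theta !opprK mulrNN -exprS.
by rewrite /euler /bump /=; ring.
Qed.

Lemma theta24_euler : theta24 = f 4 * f 6 ^+ 2 / (f 2 * f 12).
Proof.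
apply: canRL (mulrK _) _; first by rewrite unitrM !euler_unit.
have mulN k : pochhammer (X ^+ (2 * k)) (X ^+ 12)
    = pochhammer (X ^+ k) (X ^+ 6) * pochhammer (- X ^+ k) (X ^+ 6).
  by rewrite pochhammer_mulN ?fps_Xn0 // -!exprM mulnC.
rewrite (@euler_split R 3 2) // (@euler_split R 3 4) //.
rewrite !big_ord_recl !big_ord0 /= (mulN 2) (mulN 4).
rewrite /theta24 /ramanujan_theta -exprD.
by rewrite /euler /bump /=; ring.
Qed.

Let neg_f1 : neg (f 1) * (f 1 * f 4) = f 2 ^+ 3.
Proof. exact: (@fps_comp_NX_euler_odd R 1). Qed.

Let neg_f3 : neg (f 3) * (f 3 * f 12) = f 6 ^+ 3.
Proof. exact: (@fps_comp_NX_euler_odd R 3). Qed.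

Let neg_f2 : neg (f 2) = f 2. Proof. exact: (@fps_comp_NX_euler_even R 1). Qed.
Let neg_f6 : neg (f 6) = f 6. Proof. exact: (@fps_comp_NX_euler_even R 3). Qed.

Lemma theta15_euler : theta15 = f 2 ^+ 2 * f 3 * f 12 / (f 1 * f 4 * f 6).
Proof.
have uf := @euler_unit R.
rewrite -fps_comp_NX_schur_theta schur_theta_euler rmorph_div ?unitrM ?uf //=.
rewrite !rmorphM /= neg_f2 neg_f6.
apply: eqr_div_cross.
1,2: by rewrite !unitrM ?rmorph_unit ?uf.
transitivity (neg (f 1) * (f 1 * f 4) * f 6 ^+ 3); first by ring.
by rewrite neg_f1 -neg_f3; ring.
Qed.

Lemma fps_comp_X2_mul_neg p q :
  let a := fps_comp (X ^+ 2) p - X * fps_comp (X ^+ 2) q in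
  a * neg a = fps_comp (X ^+ 2) (p ^+ 2 - X * q ^+ 2).
Proof.
have NX0 := fps_NX0 R; have X20 := @fps_Xn0 R 2 isT.
have neg_comp c : neg (fps_comp (X ^+ 2) c) = fps_comp (X ^+ 2) c.
  by rewrite (fps_comp_comp _ NX0 X20) fps_comp_NXn sqrrN.
by rewrite /= !rmorphB !rmorphM /= !neg_comp !fps_compX //; ring.
Qed.

Lemma schur_theta_mul_neg : schur_theta * theta15
  = fps_comp (X ^+ 2)
      (fps_comp (X ^+ 2) theta24 ^+ 2 - X * fps_comp (X ^+ 2) theta15 ^+ 2).
Proof.
have X20 := @fps_Xn0 R 2 isT.
have comp4 c : fps_comp (X ^+ 4) c = fps_comp (X ^+ 2) (fps_comp (X ^+ 2) c).
  by rewrite (fps_comp_comp _ X20 X20) fps_comp_Xn.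
rewrite -{1}fps_comp_NX_schur_theta schur_theta_dissect !comp4.
exact: fps_comp_X2_mul_neg.
Qed.

Definition dissect_den : fps R := theta24 ^+ 4 - X * theta15 ^+ 4.

Lemma theta_sqr_diff_euler :
  fps_comp (X ^+ 2) theta24 ^+ 2 - X * fps_comp (X ^+ 2) theta15 ^+ 2
  = f 1 * f 3 * f 6 / f 2.
Proof.
have uf := @euler_unit R.
apply: (@fps_comp_Xn_inj R 2) => //.
rewrite -schur_theta_mul_neg schur_theta_euler theta15_euler.
rewrite mulr_div_unit ?unitrM ?uf // rmorph_div ?uf // !rmorphM /=.
rewrite !fps_comp_Xn_euler //.
by apply: eqr_div_cross; [rewrite !unitrM !uf | exact: uf | ring].
Qed.

Lemma dissect_den_euler : dissect_den = f 1 * f 3 ^+ 5 / (f 2 * f 6).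
Proof.
have uf := @euler_unit R.
apply: (@fps_comp_Xn_inj R 2) => //.
have -> : dissect_den = (theta24 ^+ 2) ^+ 2 - X * (theta15 ^+ 2) ^+ 2.
  by rewrite -!exprM.
rewrite -fps_comp_X2_mul_neg !rmorphXn theta_sqr_diff_euler.
rewrite !rmorph_div ?unitrM ?uf // !(rmorphM, rmorphXn) /= neg_f2 neg_f6.
rewrite !fps_comp_Xn_euler // mulr_div_unit ?uf //.
apply: eqr_div_cross.
1,2: by rewrite !unitrM !uf.
transitivity
  ((neg (f 1) * (f 1 * f 4)) * (neg (f 3) * (f 3 * f 12)) * f 6 ^+ 2).
  by ring.
by rewrite neg_f1 neg_f3; ring.
Qed.

End SchurTheta.

Section GeometricDissection.
Variables (R : comUnitRingType) (k : nat).
Hypothesis k_gt0 : (0 < k)%N.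
Local Notation X := (fps_X R).
Local Notation sub := (fps_comp (X ^+ k)).

(* This is p^k - y^k = (p - y) (p^(k-1) + ... + y^(k-1)) at y = X q. *)
Lemma fps_inv_dissection (p q : fps R) : p ^+ k - X * q ^+ k \is a GRing.unit ->
  (sub p - X * sub q)^-1
  = \sum_(r < k)
      X ^+ r * sub (p ^+ (k.-1 - r) * q ^+ r / (p ^+ k - X * q ^+ k)).
Proof.
set den := _ - _ => den_unit.
have sub_denE : sub den
    = (sub p - X * sub q)
      * \sum_(r < k) sub p ^+ (k.-1 - r) * (X * sub q) ^+ r.
  rewrite -subrXX /den rmorphB rmorphM !rmorphXn /= fps_compX ?fps_Xn0 //.
  by rewrite exprMn.
have sub_den_unit : sub den \is a GRing.unit by rewrite rmorph_unit.
have diff_unit : sub p - X * sub q \is a GRing.unit.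
  by move: sub_den_unit; rewrite sub_denE unitrM => /andP[].
apply: (mulrI diff_unit); rewrite mulrV // -(mulrV sub_den_unit) {1}sub_denE.
rewrite -mulrA mulr_suml; congr (_ * _); apply: eq_bigr => r _.
by rewrite rmorph_div // rmorphM !rmorphXn exprMn /=; ring.
Qed.

End GeometricDissection.

Section Dissection.
Variable R : comUnitRingType.
Local Notation f := (euler R).

Lemma dissect_den_unit : dissect_den R \is a GRing.unit.
Proof.
have uf := @euler_unit R.
by rewrite dissect_den_euler unitrM unitrV !unitrM !uf.
Qed.

Lemma schur_theta_inv_coef s n : (s < 4)%N ->
  (schur_theta R)^-1 (4 * n + s)%N
  = (theta24 R ^+ (3 - s) * theta15 R ^+ s / dissect_den R) n.
Proof.
move=> s4; rewrite schur_theta_dissect fps_inv_dissection //; last first.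
  exact: dissect_den_unit.
exact: (fps_coef_multisection
  (fun r => theta24 R ^+ (3 - r) * theta15 R ^+ r / dissect_den R)).
Qed.

Lemma theta_monomial_euler i j :
  theta24 R ^+ i * theta15 R ^+ j / dissect_den R
  = (f 4 * f 6 ^+ 2) ^+ i * (f 2 ^+ 2 * f 3 * f 12) ^+ j * (f 2 * f 6)
    / ((f 2 * f 12) ^+ i * (f 1 * f 4 * f 6) ^+ j * (f 1 * f 3 ^+ 5)).
Proof.
have uf := @euler_unit R.
rewrite theta24_euler theta15_euler dissect_den_euler !expr_div_n.
rewrite mulr_div_unit ?divr_div_unit //.
all: by rewrite !(unitrM, unitrX) ?unitrM ?uf.
Qed.

End Dissection.

Section SchurOverpartitions.
Local Notation f := (euler int).

Lemma overS_section s : (s < 4)%N ->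
  FPS (fun n => overS (4 * n + s))
  = (f 4 * f 6 ^+ 2) ^+ (3 - s) * (f 2 ^+ 2 * f 3 * f 12) ^+ s * (f 2 * f 6)
    / ((f 2 * f 12) ^+ (3 - s) * (f 1 * f 4 * f 6) ^+ s * (f 1 * f 3 ^+ 5)).
Proof.
move=> s4; rewrite -theta_monomial_euler; apply/fpsP => n.
by rewrite -schur_theta_inv_coef // schur_theta_qpoch -overS_gf.
Qed.

End SchurOverpartitions.

Theorem theorem3p2 :
  [/\ FPS (fun n => overS (4 * n)) =
        ('f_4 ^+ 3 * 'f_6 ^+ 7)
        / ('f_1 * 'f_2 ^+ 2 * 'f_3 ^+ 5 * 'f_12 ^+ 3),
      FPS (fun n => overS (4 * n + 1)) =
        ('f_2 * 'f_4 * 'f_6 ^+ 4)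
        / ('f_1 ^+ 2 * 'f_3 ^+ 4 * 'f_12),
      FPS (fun n => overS (4 * n + 2)) =
        ('f_2 ^+ 4 * 'f_6 * 'f_12)
        / ('f_1 ^+ 3 * 'f_3 ^+ 3 * 'f_4)
    & FPS (fun n => overS (4 * n + 3)) =
        ('f_2 ^+ 7 * 'f_12 ^+ 3)
        / ('f_1 ^+ 4 * 'f_3 ^+ 2 * 'f_4 ^+ 3 * 'f_6 ^+ 2)].
Proof.
have uf := @euler_unit int.
have section0 : FPS (fun n => overS (4 * n)) = FPS (fun n => overS (4 * n + 0)).
  by apply/fpsP => n; congr overS; rewrite addn0.
rewrite !euler_fE section0 (@overS_section 0 isT) (@overS_section 1 isT).
rewrite (@overS_section 2 isT) (@overS_section 3 isT).
split; apply: eqr_div_cross.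
all: try by rewrite !unitrM !uf.
all: ring.
Qed.
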